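(* Let $n\in\mathbb{R}_+^I$ and let $(m(t),\mathcal{L}(t))$ be a fluid solution with $\sum_{j\in i}m_{ji}(0)=n_i$ for all $i$. Then $\beta(m(t))$ decreases monotonically to $\beta^*$ as $t\to\infty$, and $$\min_{m^*\in\mathcal{M}(n)}|m(t)-m^*|\to0\quad\text{as }t\to\infty,$$ where $|\cdot|$ is the Euclidean norm. Moreover, every $m^*\in\mathcal{M}(n)$ induces via condition (4) the throughputs $\Lambda^*(n)$, i.e. $\mu_{ji}m^*_{ji}/m^*_j=\Lambda^*_i(n)$ for every route $i$ and $j\in i$ with $m^*_{ji}>0$.
   Context: Closed multiclass network: finite queue set $\mathcal{J}$, finite route set $\mathcal{I}$ ($I=|\mathcal{I}|$), each route $i$ a subset of $\mathcal{J}$ with cyclic order $(j^i_1,\dots,j^i_{k_i})$ (each queue at most once; the queue before $j^i_1$ is $j^i_{k_i}$), rates $\mu_{ji}>0$ for $j\in i$. A fluid solution is a pair $m(t)=(m_{ji}(t))$, $\mathcal{L}(t)=(\mathcal{L}_{ji}(t))$, $j\in i$, with, for all $i$, $j\in i$, $t\ge s\ge0$: (1) $m_{j^i_k i}(t)=\mathcal{L}_{j^i_{k-1}i}(t)-\mathcal{L}_{j^i_k i}(t)$; (2) $\sum_{i: j\in i}\mu_{ji}^{-1}(\mathcal{L}_{ji}(t)-\mathcal{L}_{ji}(s))\le t-s$; (3) $\mathcal{L}_{ji}$ nondecreasing; (4) if $m_j(t)>0$ (where $m_j=\sum_{i: j\in i}m_{ji}$) then $\frac{d}{dt}\mathcal{L}_{ji}(t)=\mu_{ji}m_{ji}(t)/m_j(t)$;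 (5) $\sum_{j\in i}m_{ji}(t)=n_i$. Define $\beta(m)=\sum_{j\in\mathcal{J}}\sum_{i: j\in i,\,m_{ji}>0}m_{ji}\log\frac{m_{ji}\mu_{ji}}{m_j}$ for $m\ge0$; $\beta^*$ is the minimum of $\beta(m)$ over $m\ge0$ with $\sum_{j\in i}m_{ji}=n_i$ for all $i$, and $\mathcal{M}(n)$ is the set of minimizers. $\Lambda^*(n)$ is the unique optimizer of: maximize $\sum_i n_i\log\Lambda_i$ s.t. $\sum_{i: j\in i}\Lambda_i/\mu_{ji}\le1$ for all $j$, $\Lambda\ge0$.
   Formalization: Condition (1) as printed sums to 0 around each route, contradicting (5) when n_i>0; it is read with increments from time 0: m(t)=m(0)+(increment of L at the previous queue)−(increment of L at the queue). Also m(t)≥0 is required, as β needs, and (4) is assumed only for t>0. *)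

(* Defs.v *)
From HB Require Import structures.
From mathcomp Require Import all_boot all_order all_algebra.
From mathcomp Require Import all_classical all_reals all_analysis.
Set Implicit Arguments. Unset Strict Implicit. Unset Printing Implicit Defensive.
Import Order.TTheory GRing.Theory Num.Theory.
Import numFieldNormedType.Exports.
Local Open Scope classical_set_scope.
Local Open Scope ring_scope.

(* A closed multiclass network:
   - J : finite type of queues, I : finite type of routes;
   - route i is given by the duplicate-free sequence [r i] = (j^i_1,...,j^i_{k_i})
     listing its queues in cyclic order; the queue before j on route i is
     [prev (r i) j] (path.prev, cyclic predecessor, so the one before j^i_1
     is j^i_{k_i});
   - mu j i : service rate of route i at queue j (only used for j \in r i).
   Vectors m = (m_{ji}) are represented as functions J -> I -> R; only the
   entries with j \in r i are meaningful (all definitions below ignore the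
   other entries). *)

Section Network.
Variables (R : realType) (J I : finType) (r : I -> seq J) (mu : J -> I -> R).

Definition mtot (m : J -> I -> R) (j : J) : R :=
  \sum_(i : I | j \in r i) m j i.

Definition beta (m : J -> I -> R) : R :=
  \sum_(j : J) \sum_(i : I | (j \in r i) && (0 < m j i))
     m j i * ln (m j i * mu j i / mtot m j).

Definition feasible (n : I -> R) (m : J -> I -> R) : Prop :=
  (forall i j, j \in r i -> 0 <= m j i) /\
  (forall i, \sum_(j <- r i) m j i = n i).

Definition betastar (n : I -> R) : R := inf [set beta m | m in feasible n].

Definition Mset (n : I -> R) : set (J -> I -> R) :=
  [set ms | feasible n ms /\ forall m, feasible n m -> beta ms <= beta m].

Definition enorm (m : J -> I -> R) : R :=
  Num.sqrt (\sum_(i : I) \sum_(j <- r i) (m j i) ^+ 2).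

(* Throughput optimization problem:
   maximize sum_i n_i log Lambda_i  s.t.  sum_{i : j in i} Lambda_i/mu_{ji} <= 1,
   Lambda >= 0 (with Lambda_i > 0 whenever n_i > 0, so the objective is finite;
   terms with n_i = 0 contribute 0). *)
Definition thr_feasible (n : I -> R) (Lam : I -> R) : Prop :=
  (forall i, 0 <= Lam i) /\ (forall i, 0 < n i -> 0 < Lam i) /\
  (forall j, \sum_(i : I | j \in r i) Lam i / mu j i <= 1).

Definition thr_obj (n : I -> R) (Lam : I -> R) : R :=
  \sum_(i : I) n i * ln (Lam i).

Definition thr_optimal (n : I -> R) (Lam : I -> R) : Prop :=
  thr_feasible n Lam /\
  forall Lam', thr_feasible n Lam' -> thr_obj n Lam' <= thr_obj n Lam.

Definition fluid_solution (n : I -> R)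
    (m : R -> J -> I -> R) (L : R -> J -> I -> R) : Prop :=
  [/\ (forall t i j, 0 <= t -> j \in r i ->
         m t j i = m 0 j i + (L t (prev (r i) j) i - L 0 (prev (r i) j) i)
                           - (L t j i - L 0 j i)) /\
      (forall s t j, 0 <= s -> s <= t ->
         \sum_(i : I | j \in r i) (L t j i - L s j i) / mu j i <= t - s),
      (forall s t i j, 0 <= s -> s <= t -> j \in r i -> L s j i <= L t j i),
      (forall t i j, 0 < t -> j \in r i -> 0 < mtot (m t) j ->
         is_derive t (1 : R) (fun x => L x j i) (mu j i * m t j i / mtot (m t) j)),
      (forall t i, 0 <= t -> \sum_(j <- r i) m t j i = n i) &
      (forall t i j, 0 <= t -> j \in r i -> 0 <= m t j i)].

End Network.

(* Main.v *)
Require Import Defs.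
From HB Require Import structures.
From mathcomp Require Import all_boot all_order all_algebra.
From mathcomp Require Import all_classical all_reals all_analysis.
From mathcomp Require Import ring lra.
Set Implicit Arguments. Unset Strict Implicit. Unset Printing Implicit Defensive.
Import Order.TTheory GRing.Theory Num.Theory.
Import numFieldNormedType.Exports.
Local Open Scope classical_set_scope.
Local Open Scope ring_scope.

(** By Gibbs' inequality, beta m is the maximum of sum m_ji ln Lam_ji over rates
    with sum_i Lam_ji / mu_ji <= 1 at every queue j, attained exactly at
    Lam_ji = mu_ji m_ji / m_j. Taking Lam_ji independent of j gives weak duality
    with the throughput problem, together with its equality case.

    Comparing m(s) and m(t) through the rates which are optimal for m(t), and which
    at empty queues are the mean rates over [s, t], shows that the left upper Dini
    derivative of beta (m t) is at most -D, where the dissipation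
    D = sum Lam_prev (ln Lam_prev - ln Lam) over the cyclic routes is nonnegative.
    So beta decreases, and as it is bounded below there are times at which D is
    arbitrarily small, i.e. at which the rates are almost constant along each route.
    Such rates yield almost optimal throughputs, which closes the duality gap.
    The limits are taken along ultrafilters, coordinate by coordinate. *)

(** * Analytic preliminaries *)

(** Compactness of the interval gives a cluster point, and an ultrafilter converges to each of its
    cluster points. *)
Lemma ultra_bounded_cvg (R : realType) (T : Type) (U : set_system T)
    (f : T -> R) (a b : R) :
  UltraFilter U -> (\forall x \near U, a <= f x <= b) ->
  exists l : R, f x @[x --> U] --> l.
Proof.
move=> UU fab; have PU := ultra_proper.
have [p [_ clp]] : `[a, b] `&` cluster (f x @[x --> U]) !=set0.
  apply: (segment_compact (a := a) (b := b)).
  by apply: filterS fab => x; rewrite /= in_itv.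
exists p => B pB.
have [//|UNB] := in_ultra_setVsetC (f @^-1` B) UU.
by have [y [NBy By]] := clp (~` B) B UNB pB.
Qed.

(** Squaring [1 + u / 2 <= expR (u / 2)] produces the term [u ^+ 2 / 4] when [-2 <= u]; below [-2],
    positivity of [expR] suffices. *)
Lemma expR_sub_quad_ge (R : realType) (u e : R) :
  0 <= e -> e <= 2 -> e <= `|u| -> e ^+ 2 / 4 <= expR u - 1 - u.
Proof.
move=> e0 e2 eu.
have e2u : e ^+ 2 <= u ^+ 2 by rewrite -(real_normK (num_real u)) lerXn2r ?nnegrE.
have [u2|u2] := lerP (-2) u; last first.
  have := expR_gt0 u; nra.
have h1 := expR_ge1Dx (u / 2).
have h2 : (1 + u / 2) ^+ 2 <= expR u.
  rewrite [in leRHS](_ : u = u / 2 + u / 2); last by lra.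
  rewrite expRD -expr2 lerXn2r ?nnegrE ?expR_ge0//; lra.
nra.
Qed.

(** To the left of 0 the product vanishes, since [ln] is 0 there. To the right, [y = z ^+ 2] and
    [- ln z <= z^-1] bound it by [2 * z] in absolute value. *)
Lemma continuous_xlnx (R : realType) : continuous (fun x : R => x * ln x).
Proof.
move=> x; have [x0|x0|->] := ltgtP x 0.
- rewrite /continuous_at ln0 ?mulr0; last exact: ltW.
  apply/cvgrPdist_le => e e0; near=> y.
  rewrite ln0 ?mulr0 ?subrr ?normr0 ?(ltW e0)//.
  apply: ltW; near: y; exact: lt_nbhsl.
- by apply: cvgM; [exact: cvg_id|exact: continuous_ln].
- rewrite /continuous_at mul0r; apply/cvgr0Pnorm_le => e e0; near=> y.
  have [y0|y0] := lerP y 0; first by rewrite ln0// mulr0 normr0 ltW.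
  set z := Num.sqrt y.
  have z0 : 0 < z by rewrite sqrtr_gt0.
  have yz : y = z ^+ 2 by rewrite sqr_sqrtr// ltW.
  have y1 : y <= 1 by apply: ltW; near: y; exact: lt_nbhsl.
  have ye : y <= (e / 2) ^+ 2.
    by apply: ltW; near: y; apply: lt_nbhsl; rewrite exprn_gt0// divr_gt0.
  have ze : z <= e / 2.
    by rewrite -(@ler_pXn2r _ 2)// ?nnegrE -?yz ?(ltW z0)// divr_ge0 ?ltW.
  have lny : ln y <= 0 by exact: ln_le0.
  rewrite normrM gtr0_norm// ler0_norm// yz lnXn//.
  have : ln z^-1 < z^-1 by apply: ln_sublinear; rewrite invr_gt0.
  rewrite lnV ?posrE// => h.
  have : z * (- ln z) <= 1 by rewrite -(mulfV (lt0r_neq0 z0)) ler_pM2l// ltW.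
  nra.
Unshelve. all: by end_near.
Qed.

(* The decrease rate k is only assumed from the left at each positive time, which
   is enough: the function minus its claimed linear bound cannot be maximal at an
   interior point or a right end point. *)
Lemma left_dini_decrease (R : realType) (f : R -> R) (k : R) :
  continuous f ->
  (forall t, 0 < t -> forall e, 0 < e ->
     \forall s \near t^'-, f t - f s <= (t - s) * (e - k)) ->
  forall s t, 0 <= s -> s <= t -> f t - f s <= - k * (t - s).
Proof.
move=> cf df s t s0 st.
suff H e : 0 < e -> f t - f s <= (e - k) * (t - s).
  apply/ler_addgt0Pr => e e0.
  have ts1 : 0 < t - s + 1 by lra.
  have := H (e / (t - s + 1)) (divr_gt0 e0 ts1).
  have : e / (t - s + 1) * (t - s) <= e.
    by rewrite mulrAC ler_pdivrMr//; nra.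
  nra.
move=> e0; pose g x := f x - (e - k) * x.
have cg : continuous g.
  move=> x; apply: cvgB; first exact: cf.
  by apply: cvgM; [exact: cvg_cst|exact: cvg_id].
have [c] : exists2 c, c \in `[s, t] & forall x, x \in `[s, t] -> g x <= g c.
  by apply: EVT_max => //; exact: continuous_subspaceT.
rewrite in_itv/= => /andP[sc ct] cmax.
suff -> : f s = g c + (e - k) * s.
  by have := cmax t; rewrite in_itv/= st lexx/g => /(_ isT); lra.
have [<-|nsc] := eqVneq s c; first by rewrite /g; lra.
have ltsc : s < c by rewrite lt_neqAle nsc.
have c0 : 0 < c by exact: le_lt_trans ltsc.
(* Spending only [e / 2] makes the bounds on [f c - f y] from maximality and from the assumed rate
   contradict each other. *)
have e20 : 0 < e / 2 by lra.
near (c^'-) => y.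
have sy : s < y by near: y; exact: nbhs_left_gt.
have yc : y < c by near: y; exact: nbhs_left_lt.
have fy : f c - f y <= (c - y) * (e / 2 - k) by near: y; exact: df.
have := cmax y; rewrite in_itv/= (ltW sy) (le_trans (ltW yc) ct) => /(_ isT).
rewrite /g => h.
exfalso; nra.
Unshelve. all: by end_near.
Qed.

Lemma is_derive_cvg_left (R : realType) (f : R -> R) (t l : R) :
  is_derive t 1 f l -> (f t - f s) / (t - s) @[s --> t^'-] --> l.
Proof.
move=> [df <-]; have h := cvg_dnbhs_at_left (df : cvg _).
apply/cvgrPdist_le => e e0.
have /cvgrPdist_le/(_ e e0) h' := h.
apply/nbhs_left0P.
have /(@nbhs_left0P R 0) := h'.
apply: filterS => x /=; rewrite sub0r /shift/= /GRing.scale/= mulr1.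
suff -> : (f t - f (t - x)) / (t - (t - x)) = (- x)^-1 * (f (- x + t) - f t) by [].
have -> : t - (t - x) = x by lra.
by rewrite invrN mulNr -mulrN opprB mulrC (addrC t).
Qed.

(** * Cyclic sequences and finite sums *)

(** Rotating [p] to start at [x0] turns the cycle into a path for [next], where induction on the
    sequence applies. *)
Lemma cyclic_ind (T : eqType) (p : seq T) (Q : T -> Prop) (x0 : T) :
  uniq p -> x0 \in p -> Q x0 ->
  (forall x, x \in p -> Q (prev p x) -> Q x) -> forall x, x \in p -> Q x.
Proof.
move=> up x0p Q0 QS.
have QN x : x \in p -> Q x -> Q (next p x).
  by move=> xp Qx; apply: QS; rewrite ?mem_next ?prev_next.
have [i q pq] := rot_to x0p.
have : fpath (next p) x0 q.
  have : fcycle (next p) (rot i p) by rewrite rot_cycle; exact: cycle_next.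
  by rewrite pq /= rcons_path => /andP[].
have sub x : x \in x0 :: q -> x \in p by rewrite -pq mem_rot.
move=> pth x; rewrite -(mem_rot i) pq.
elim: q {pq} x0 pth Q0 sub {x0p} => [|y q IH] x0 /=.
  by move=> _ Q0 _; rewrite inE => /eqP ->.
case/andP=> /eqP <- pth Q0 sub; rewrite inE => /predU1P[->//|].
apply: IH => //; first by apply: QN => //; apply: sub; rewrite inE eqxx.
by move=> z zq; apply: sub; rewrite inE zq orbT.
Qed.

(** Steps are controlled only above the level [A]. The initial margin of [size p] times [e] pays for
    every step, so the walk never drops below [A]. *)
Lemma cyclic_near_const (R : realType) (T : eqType) (p : seq T) (y : T -> R)
    (x0 : T) (A e : R) :
  uniq p -> x0 \in p -> 0 <= e -> A + (size p)%:R * e <= y x0 ->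
  (forall x, x \in p -> A <= y x -> `|y (next p x) - y x| <= e) ->
  forall x, x \in p -> `|y x - y x0| <= (size p)%:R * e.
Proof.
move=> up x0p e0 A0 step.
have [i q pq] := rot_to x0p.
have : fpath (next p) x0 q.
  have : fcycle (next p) (rot i p) by rewrite rot_cycle; exact: cycle_next.
  by rewrite pq /= rcons_path => /andP[].
have sub x : x \in x0 :: q -> x \in p by rewrite -pq mem_rot.
have szp : size p = (size q).+1 by rewrite -(size_rot i) pq.
rewrite szp in A0 *.
move=> pth x; rewrite -(mem_rot i) pq.
elim: q {pq szp} x0 pth A0 sub {x0p} => [|z q IH] x0 /=.
  by move=> _ _ _; rewrite inE => /eqP ->; rewrite subrr normr0 mul1r.
case/andP=> /eqP <- pth A0 sub; rewrite inE => /predU1P[->|].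
  by rewrite subrr normr0 mulr_ge0.
set n := (size q).+1 in IH A0 *.
have n0 : 0 <= n%:R * e by rewrite mulr_ge0.
have x0z : `|y (next p x0) - y x0| <= e.
  apply: step; first by apply: sub; rewrite inE eqxx.
  move: A0; rewrite -natr1; lra.
move=> xq; apply: le_trans (ler_distD (y (next p x0)) _ _) _.
rewrite -natr1 mulrDl mul1r; apply: lerD => //.
apply: IH => //; last by move=> w wq; apply: sub; rewrite inE wq orbT.
move: A0 x0z; rewrite -natr1 ler_distlC => A0 /andP[]; lra.
Qed.

Lemma big_prev (R : zmodType) (T : eqType) (p : seq T) (F : T -> R) :
  uniq p -> \sum_(x <- p) F (prev p x) = \sum_(x <- p) F x.
Proof.
move=> up; rewrite -(big_map (prev p) xpredT F); apply: perm_big.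
have uprev : uniq (map (prev p) p).
  by rewrite map_inj_uniq//; exact: can_inj (next_prev up).
apply: uniq_perm => // x; apply/mapP/idP.
  by move=> [y yp ->]; rewrite mem_prev.
by move=> xp; exists (next p x); rewrite ?mem_next ?prev_next.
Qed.

Lemma ler_term_sum (R : numDomainType) (T : finType) (P : pred T) (F : T -> R) x :
  (forall y, P y -> 0 <= F y) -> P x -> F x <= \sum_(y | P y) F y.
Proof.
move=> F0 Px; rewrite (bigD1 x)//= lerDl sumr_ge0// => y /andP[Py _].
exact: F0.
Qed.

Lemma cvg_sumr (R : realType) (T : Type) (F : set_system T) (A : Type)
    (s : seq A) (P : pred A) (f : A -> T -> R) (l : A -> R) :
  Filter F -> (forall a, P a -> f a x @[x --> F] --> l a) ->
  \sum_(a <- s | P a) f a x @[x --> F] --> \sum_(a <- s | P a) l a.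
Proof. by move=> FF fl; apply: cvg_big => //; exact: add_continuous. Qed.

(** * Gibbs' inequality and duality with the throughput problem *)

Section Duality.
Variables (R : realType) (J I : finType) (r : I -> seq J) (mu : J -> I -> R).
Hypothesis ur : forall i, uniq (r i).
Hypothesis mu0 : forall i j, j \in r i -> 0 < mu j i.
Implicit Types (m Lam : J -> I -> R) (n : I -> R).

Lemma sum_routes (F : J -> I -> R) :
  \sum_j \sum_(i | j \in r i) F j i = \sum_i \sum_(j <- r i) F j i.
Proof.
rewrite (exchange_big_dep xpredT)//=.
by apply: eq_bigr => i _; rewrite big_uniq.
Qed.

Lemma ler_term_routes (F : J -> I -> R) i j :
  (forall i j, j \in r i -> 0 <= F j i) -> j \in r i ->
  F j i <= \sum_j \sum_(i | j \in r i) F j i.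
Proof.
move=> F0 ji; apply: (@le_trans _ _ (\sum_(i | j \in r i) F j i)).
  by apply: (@ler_term_sum _ _ (fun i => j \in r i)) => // k; exact: F0.
apply: (@ler_term_sum _ _ xpredT (fun j => \sum_(i | j \in r i) F j i)) => // k _.
by apply: sumr_ge0 => l; exact: F0.
Qed.

Definition mass_ge0 m := forall i j, j \in r i -> 0 <= m j i.

Lemma mtot_ge m i j : mass_ge0 m -> j \in r i -> m j i <= mtot r m j.
Proof.
by move=> m0 ji; apply: (@ler_term_sum _ _ (fun i => j \in r i)) => // k; exact: m0.
Qed.

Lemma betaE m : mass_ge0 m ->
  beta r mu m =
  \sum_j \sum_(i | j \in r i) m j i * ln (m j i * mu j i / mtot r m j).
Proof.
move=> m0; apply: eq_bigr => j _; rewrite big_mkcondr/=.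
apply: eq_bigr => i ji; case: ltP => // mji.
have -> : m j i = 0 by apply/eqP; rewrite eq_le mji m0.
by rewrite mul0r.
Qed.

Definition service_feasible Lam :=
  (forall i j, j \in r i -> 0 <= Lam j i) /\
  (forall j, \sum_(i | j \in r i) Lam j i / mu j i <= 1).

Definition gibbs_gap m Lam j i : R :=
  m j i * (ln (m j i * mu j i / mtot r m j) - ln (Lam j i)) -
  (m j i - mtot r m j * (Lam j i / mu j i)).

(** In this form [1 + u <= expR u] gives the sign, and its strictness off [u = 0] gives the equality
    case. *)
Lemma gibbs_gap_eq m Lam i j : j \in r i -> 0 < m j i -> 0 < mtot r m j ->
  0 < Lam j i ->
  let u := ln (Lam j i) - ln (m j i * mu j i / mtot r m j) in
  gibbs_gap m Lam j i = m j i * (expR u - 1 - u).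
Proof.
move=> ji mji mj L0 u.
have muji := mu0 ji.
have x0 : 0 < m j i * mu j i / mtot r m j by rewrite divr_gt0 ?mulr_gt0.
have -> : expR u = Lam j i / (m j i * mu j i / mtot r m j).
  by rewrite expRB !lnK.
rewrite /gibbs_gap /u; field.
by rewrite !gt_eqF.
Qed.

Lemma gibbs_gap_ge0 m Lam i j : j \in r i -> mass_ge0 m ->
  0 <= Lam j i -> (0 < m j i -> 0 < Lam j i) -> 0 <= gibbs_gap m Lam j i.
Proof.
move=> ji m0 L0 mL; have mle := mtot_ge m0 ji.
have [mji|mji] := ltP 0 (m j i).
  rewrite (gibbs_gap_eq ji) ?mL//; last exact: lt_le_trans mle.
  apply: mulr_ge0; first exact: ltW.
  by rewrite -addrA -opprD subr_ge0 expR_ge1Dx.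
have -> : gibbs_gap m Lam j i = mtot r m j * (Lam j i / mu j i).
  have mz : m j i = 0 by apply/eqP; rewrite eq_le mji m0.
  by rewrite /gibbs_gap mz; ring.
rewrite mulr_ge0 ?divr_ge0//; first exact: le_trans (m0 _ _ ji) mle.
by rewrite ltW// mu0.
Qed.

Lemma sum_gibbs_gap m Lam : mass_ge0 m -> service_feasible Lam ->
  \sum_j \sum_(i | j \in r i) gibbs_gap m Lam j i <=
  beta r mu m - \sum_j \sum_(i | j \in r i) m j i * ln (Lam j i).
Proof.
move=> m0 [L0 LK]; rewrite betaE// -sumrB; apply: ler_sum => j _.
under eq_bigr do rewrite /gibbs_gap mulrBr.
rewrite !sumrB lerBlDl lerDr -mulr_sumr subr_ge0.
rewrite -[leRHS]mulr1 ler_wpM2l//.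
by apply: sumr_ge0 => i; exact: m0.
Qed.

Lemma gibbs_le m Lam i j : j \in r i -> mass_ge0 m -> service_feasible Lam ->
  (forall i j, j \in r i -> 0 < m j i -> 0 < Lam j i) ->
  gibbs_gap m Lam j i <=
  beta r mu m - \sum_j \sum_(i | j \in r i) m j i * ln (Lam j i).
Proof.
move=> ji m0 LK mL; apply: le_trans (sum_gibbs_gap m0 LK).
apply: ler_term_routes => // k l lk.
by apply: gibbs_gap_ge0 => //; [exact: LK.1|exact: mL].
Qed.

Lemma gibbs m Lam : mass_ge0 m -> service_feasible Lam ->
  (forall i j, j \in r i -> 0 < m j i -> 0 < Lam j i) ->
  \sum_j \sum_(i | j \in r i) m j i * ln (Lam j i) <= beta r mu m.
Proof.
move=> m0 LK mL; rewrite -subr_ge0; apply: le_trans (sum_gibbs_gap m0 LK).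
apply: sumr_ge0 => j _; apply: sumr_ge0 => i ji.
by apply: gibbs_gap_ge0 => //; [exact: LK.1|exact: mL].
Qed.

Lemma feasible_le n m i j : feasible r n m -> j \in r i -> m j i <= n i.
Proof.
move=> [m0 mn] ji; rewrite -mn big_uniq//=.
by apply: (@ler_term_sum _ _ (fun j => j \in r i) (fun j => m j i)) => // k; exact: m0.
Qed.

Lemma feasible_gt0 n m i j : feasible r n m -> j \in r i -> 0 < m j i -> 0 < n i.
Proof. by move=> fm ji mji; exact: lt_le_trans mji (feasible_le fm ji). Qed.

Lemma thr_service_feasible {n} {Lam : I -> R} : thr_feasible r mu n Lam ->
  service_feasible (fun _ => Lam).
Proof. by move=> [L0 [_ LK]]; split => // i j _; exact: L0. Qed.

Lemma thr_objE n m (Lam : I -> R) : feasible r n m ->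
  thr_obj n Lam = \sum_j \sum_(i | j \in r i) m j i * ln (Lam i).
Proof.
move=> [_ mn]; rewrite sum_routes; apply: eq_bigr => i _.
by rewrite -mn mulr_suml.
Qed.

Lemma weak_duality n m (Lam : I -> R) :
  feasible r n m -> thr_feasible r mu n Lam -> thr_obj n Lam <= beta r mu m.
Proof.
move=> fm fL; rewrite (thr_objE _ fm).
apply: (@gibbs m (fun _ => Lam)); first exact: fm.1.
  exact: thr_service_feasible fL.
by move=> i j ji mji; apply: fL.2.1; exact: feasible_gt0 mji.
Qed.

(** Without a duality gap every Gibbs gap is at most 0, and [expR u - 1 - u] vanishes only at
    [u = 0]. *)
Lemma duality_eq n m (Lam : I -> R) :
  feasible r n m -> thr_feasible r mu n Lam -> beta r mu m <= thr_obj n Lam ->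
  forall i j, j \in r i -> 0 < m j i -> mu j i * m j i / mtot r m j = Lam i.
Proof.
move=> fm fL; rewrite (thr_objE _ fm) => le i j ji mji.
have mj : 0 < mtot r m j by exact: lt_le_trans mji (mtot_ge fm.1 ji).
have L0 i' j' : j' \in r i' -> 0 < m j' i' -> 0 < Lam i'.
  by move=> ji' mji'; apply: fL.2.1; exact: feasible_gt0 mji'.
have := @gibbs_le m (fun _ => Lam) i j ji fm.1 (thr_service_feasible fL) L0.
have Li := L0 i j ji mji.
rewrite (gibbs_gap_eq ji)//=.
set u := ln (Lam i) - _ => h.
have {le}h : m j i * (expR u - 1 - u) <= 0 by apply: le_trans h _; rewrite subr_le0.
have u0 : u = 0.
  apply/eqP; apply/negPn/negP => /expR_gt1Dx h1; rewrite pmulr_rle0// in h; lra.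
apply/esym/ln_inj; rewrite ?posrE// ?divr_gt0 ?mulr_gt0 ?mu0//.
by apply/eqP; rewrite -subr_eq0 (mulrC (mu j i)) -/u u0.
Qed.

Lemma beta_lbound n : exists c, forall m, feasible r n m -> c <= beta r mu m.
Proof.
pose S := \sum_j \sum_(i | j \in r i) (mu j i)^-1.
have S0 : 0 <= S.
  by apply: sumr_ge0 => j _; apply: sumr_ge0 => i ji; rewrite invr_ge0 ltW// mu0.
have S1 : 0 < 1 + S by lra.
exists (thr_obj n (fun _ => (1 + S)^-1)) => m fm; apply: weak_duality => //.
split; [|split] => [i|i _|j]; rewrite ?invr_ge0 ?invr_gt0 ?(ltW S1)//.
rewrite -mulr_sumr mulrC ler_pdivrMr// mul1r.
apply: (@le_trans _ _ S); last by lra.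
apply: (@ler_term_sum _ _ xpredT (fun j => \sum_(i | j \in r i) (mu j i)^-1)) => // k _.
by apply: sumr_ge0 => i ki; rewrite invr_ge0 ltW// mu0.
Qed.

(** Splitting the logarithm leaves linear terms and terms [x * ln x], which are continuous even
    where masses vanish. *)
Lemma beta_xlnx m : mass_ge0 m ->
  beta r mu m = \sum_j (\sum_(i | j \in r i)
                  (m j i * ln (mu j i) + m j i * ln (m j i))
                - mtot r m j * ln (mtot r m j)).
Proof.
move=> m0; rewrite betaE//; apply: eq_bigr => j _.
rewrite {2}/mtot mulr_suml -sumrB; apply: eq_bigr => i ji.
have [mji|mji] := ltP 0 (m j i); last first.
  have -> : m j i = 0 by apply/eqP; rewrite eq_le mji m0.
  by rewrite !mul0r addr0 subrr.
have mj : 0 < mtot r m j by exact: lt_le_trans mji (mtot_ge m0 ji).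
have muji := mu0 ji.
rewrite ln_div ?posrE ?mulr_gt0// lnM ?posrE//; ring.
Qed.

Lemma cvg_beta (T : Type) (F : set_system T) (f : T -> J -> I -> R) m :
  ProperFilter F -> (\forall x \near F, mass_ge0 (f x)) ->
  (forall i j, j \in r i -> f x j i @[x --> F] --> m j i) ->
  beta r mu (f x) @[x --> F] --> beta r mu m.
Proof.
move=> FF f0 fm.
have m0 : mass_ge0 m.
  move=> i j ji; apply: (cvgr_to_ge (fm i j ji)).
  by apply: filterS f0 => x; apply.
have cxlnx (g : T -> R) (l : R) : g x @[x --> F] --> l ->
    g x * ln (g x) @[x --> F] --> l * ln l.
  by move=> gl; apply: (continuous_cvg _ (@continuous_xlnx R l) gl).
rewrite beta_xlnx//.
apply: (cvg_trans (near_eq_cvg (filterS (fun x fx0 => esym (@beta_xlnx (f x) fx0)) f0))).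
apply: cvg_sumr => j _; apply: cvgB; last first.
  by apply: cxlnx; apply: cvg_sumr => i ji; exact: fm.
apply: cvg_sumr => i ji; apply: cvgD; last by apply: cxlnx; exact: fm.
by apply: cvgM; [exact: fm|exact: cvg_cst].
Qed.

End Duality.

(** * Dissipation around the cyclic routes *)

Section Dissipation.
Variables (R : realType) (J I : finType) (r : I -> seq J) (mu : J -> I -> R).
Variable n : I -> R.
Hypothesis ur : forall i, uniq (r i).
Hypothesis mu0 : forall i j, j \in r i -> 0 < mu j i.
Implicit Types m Lam : J -> I -> R.

(* At an empty queue condition (4) says nothing, so there the rates are only
   required to be feasible. *)
Definition rates_of m Lam :=
  [/\ service_feasible r mu Lam,
      forall i j, j \in r i -> 0 < n i -> 0 < Lam j i &
      forall i j, j \in r i -> 0 < m j i -> Lam j i = mu j i * m j i / mtot r m j].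

(** Route by route, this is the relative entropy of the rates shifted by one queue with respect to
    the rates themselves. Only routes with [0 < n i] enter, as rates may vanish elsewhere. *)
Definition dissipation Lam : R :=
  \sum_(i | 0 < n i) \sum_(j <- r i)
    Lam (prev (r i) j) i * (ln (Lam (prev (r i) j) i) - ln (Lam j i)).

Lemma beta_rates m Lam : mass_ge0 r m -> rates_of m Lam ->
  beta r mu m = \sum_j \sum_(i | j \in r i) m j i * ln (Lam j i).
Proof.
move=> m0 [_ _ LE]; rewrite betaE//; apply: eq_bigr => j _; apply: eq_bigr => i ji.
have [mji|mji] := ltP 0 (m j i); first by rewrite (LE _ _ ji)// (mulrC (mu j i)).
have -> : m j i = 0 by apply/eqP; rewrite eq_le mji m0.
by rewrite !mul0r.
Qed.

Lemma service_feasible_le Lam i j :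
  service_feasible r mu Lam -> j \in r i -> Lam j i <= mu j i.
Proof.
move=> [L0 LK] ji; rewrite -[leRHS]mul1r -ler_pdivrMr ?mu0//.
apply: le_trans (LK j); apply: (@ler_term_sum _ _ (fun i => j \in r i) (fun i => Lam j i / mu j i)) => //.
by move=> k jk; rewrite divr_ge0 ?L0// ltW// mu0.
Qed.

(** Exceeds the summand of [dissipation] by the difference of the rates at [j] and at its
    predecessor. This sums to 0 around the route and makes each term nonnegative by itself. *)
Definition dissipation_term Lam i j : R :=
  let u := ln (Lam j i) - ln (Lam (prev (r i) j) i) in
  Lam (prev (r i) j) i * (expR u - 1 - u).

Lemma dissipation_termE Lam : (forall i j, j \in r i -> 0 < n i -> 0 < Lam j i) ->
  dissipation Lam = \sum_(i | 0 < n i) \sum_(j <- r i) dissipation_term Lam i j.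
Proof.
move=> L0; apply: eq_bigr => i ni.
rewrite -[LHS]add0r -[X in X + _](subrr (\sum_(j <- r i) Lam j i)).
rewrite -[X in _ - X + _](big_prev (fun j => Lam j i) (ur i)) -sumrB -big_split/=.
rewrite big_seq [RHS]big_seq; apply: eq_bigr => j ji.
have pj : prev (r i) j \in r i by rewrite mem_prev.
have Lp := L0 _ _ pj ni.
rewrite /dissipation_term expRB !lnK ?posrE ?L0//; field.
by rewrite gt_eqF.
Qed.

Lemma dissipation_term_ge0 Lam i j :
  0 <= Lam (prev (r i) j) i -> 0 <= dissipation_term Lam i j.
Proof. by move=> L0; rewrite mulr_ge0// -addrA -opprD subr_ge0 expR_ge1Dx. Qed.

Lemma dissipation_ge0 Lam : (forall i j, j \in r i -> 0 < n i -> 0 < Lam j i) ->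
  0 <= dissipation Lam.
Proof.
move=> L0; rewrite dissipation_termE//; apply: sumr_ge0 => i ni.
rewrite big_seq; apply: sumr_ge0 => j ji.
by apply: dissipation_term_ge0; rewrite ltW// L0// mem_prev.
Qed.

Lemma dissipation_term_le Lam i j :
  (forall i j, j \in r i -> 0 < n i -> 0 < Lam j i) -> 0 < n i -> j \in r i ->
  dissipation_term Lam i j <= dissipation Lam.
Proof.
move=> L0 ni ji; rewrite dissipation_termE//.
have T0 k l : 0 < n k -> l \in r k -> 0 <= dissipation_term Lam k l.
  by move=> nk lk; apply: dissipation_term_ge0; rewrite ltW// L0// mem_prev.
apply: (@le_trans _ _ (\sum_(j <- r i) dissipation_term Lam i j)).
  rewrite big_uniq//; apply: (@ler_term_sum _ _ (fun j => j \in r i)) => // l.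
  exact: T0.
apply: (@ler_term_sum _ _ (fun i => 0 < n i)
  (fun i => \sum_(j <- r i) dissipation_term Lam i j)) => // k nk.
by rewrite big_seq; apply: sumr_ge0 => l; exact: T0.
Qed.

Lemma mtot_le m j : (forall i, 0 <= n i) -> feasible r n m ->
  mtot r m j <= \sum_i n i.
Proof.
move=> n0 fm; rewrite /mtot big_mkcond/=; apply: ler_sum => i _.
by case: ifP => // ji; exact: (feasible_le ur fm ji).
Qed.

(* On route i some queue holds a fixed fraction of the mass, so its rate is
   bounded below; walking along the cycle from there, a small dissipation keeps
   every step, hence every rate, close in logarithm. *)
Lemma small_dissipation (delta : R) : (forall i, 0 <= n i) -> 0 < delta ->
  exists2 eta, 0 < eta & forall m Lam, feasible r n m -> rates_of m Lam ->
    dissipation Lam < eta -> forall i j k, 0 < n i -> j \in r i -> k \in r i ->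
    `|ln (Lam j i) - ln (Lam k i)| <= delta.
Proof.
move=> n0 d0.
pose P i eta := 0 < n i -> forall m Lam, feasible r n m -> rates_of m Lam ->
    dissipation Lam < eta -> forall j k, j \in r i -> k \in r i ->
    `|ln (Lam j i) - ln (Lam k i)| <= delta.
(* Asking for all small [eta] lets the finitely many routes be treated one at a time. *)
suff H : \forall eta \near 0^'+, forall i, P i eta.
  near (0 : R)^'+ => eta; exists eta; first by near: eta; exact: nbhs_right_gt.
  have Peta : forall i, P i eta by near: eta.
  by move=> m Lam fm rL dL i j k ni; exact: (Peta i ni m Lam fm rL dL j k).
apply: filter_forall => i.
have [ni|nni] := boolP (0 < n i); last first.
  by apply: nearW => eta; rewrite /P (negbTE nni).
pose N := \sum_i n i; pose K : R := (size (r i))%:R.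
have N0 : 0 < N.
  by apply: lt_le_trans ni _; apply: (@ler_term_sum _ _ xpredT).
have K0 : 0 <= K by rewrite /K.
have K1 : 0 < K + 1 by lra.
(* A lower bound for the rate at a queue [j] holding at least [n i / (K + 1)] of route [i], since
   the total mass of a queue is at most [N]. *)
pose b j := mu j i * (n i / (K + 1)) / N.
have [c c0 cb] : exists2 c, 0 < c & forall j, j \in r i -> c <= b j.
  have bnear : \forall c \near (0 : R)^'+, forall j, j \in r i -> c <= b j.
    apply: filter_forall => j; have [ji|_] := boolP (j \in r i); last exact: nearW.
    near=> c => _; near: c; apply: nbhs_right_le.
    by rewrite !(divr_gt0, mulr_gt0) ?mu0.
  near (0 : R)^'+ => c; exists c; first by near: c; exact: nbhs_right_gt.
  by near: c.
(* Any two queues are compared through one starting queue, at cost [2 * (K * e)]; [e <= 1] keeps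
   [expR_sub_quad_ge] applicable. *)
pose e := Num.min 1 (delta / (2 * (K + 1))).
have e0 : 0 < e by rewrite lt_min ltr01 divr_gt0// mulr_gt0.
have e1 : e <= 1 by rewrite /e ge_min lexx.
have eK : 2 * (K * e) <= delta.
  have : e <= delta / (2 * (K + 1)) by rewrite /e ge_min lexx orbT.
  rewrite ler_pdivlMr; last by lra.
  by move=> h; apply: le_trans h; lra.
(* A floor for the logarithmic rates: [K] steps of size [e] down from [ln c]. *)
pose A := ln c - K * e.
near=> eta => _ m Lam fm [LK L0 LE] dL.
(* A jump larger than [e] from a rate of at least [expR A] dissipates at least this amount. *)
have eta_le : eta <= expR A * (e ^+ 2 / 4).
  near: eta; apply: nbhs_right_le.
  by rewrite mulr_gt0 ?expR_gt0 ?divr_gt0 ?exprn_gt0.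
have [j0 j0i mj0] : exists2 j, j \in r i & n i / (K + 1) <= m j i.
  apply: contrapT => hN.
  have : \sum_(j <- r i) m j i <= \sum_(j <- r i) (n i / (K + 1)).
    rewrite big_seq [leRHS]big_seq; apply: ler_sum => j ji.
    by rewrite leNgt; apply/negP => /ltW h; apply: hN; exists j.
  rewrite fm.2 big_const_seq count_predT iter_addr_0 -mulr_natr -/K.
  by rewrite mulrAC ler_pdivlMr//; nra.
have mj0_gt0 : 0 < m j0 i by apply: lt_le_trans mj0; rewrite divr_gt0.
have Lj0 : c <= Lam j0 i.
  rewrite LE//; apply: le_trans (cb _ j0i) _; rewrite /b.
  have tot0 : 0 < mtot r m j0 by apply: lt_le_trans (mtot_ge fm.1 j0i).
  apply: ler_pM.
  - by rewrite mulr_ge0 ?divr_ge0 ?(ltW K1) ?(ltW ni)// ltW// mu0.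
  - by rewrite invr_ge0 ltW.
  - by rewrite ler_pM2l ?mu0.
  - by rewrite lef_pV2 ?posrE// mtot_le.
have step j : j \in r i -> A <= ln (Lam j i) ->
    `|ln (Lam (next (r i) j) i) - ln (Lam j i)| <= e.
  move=> ji Aj; rewrite leNgt; apply/negP => h.
  have nji : next (r i) j \in r i by rewrite mem_next.
  have := dissipation_term_le L0 ni nji.
  rewrite /dissipation_term prev_next//=.
  set u := ln _ - ln _ in h *.
  have q : e ^+ 2 / 4 <= expR u - 1 - u.
    by apply: expR_sub_quad_ge; [exact: ltW|lra|exact: ltW].
  have AL : expR A <= Lam j i.
    by rewrite -[leRHS]lnK ?posrE ?L0// ler_expR.
  have : expR A * (e ^+ 2 / 4) <= Lam j i * (expR u - 1 - u).
    by apply: ler_pM; rewrite ?expR_ge0// divr_ge0// exprn_ge0// ltW.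
  lra.
have near_j0 j : j \in r i -> `|ln (Lam j i) - ln (Lam j0 i)| <= K * e.
  apply: (cyclic_near_const (ur i) j0i (ltW e0) _ step).
  by rewrite -/K /A subrK ler_ln ?posrE// L0.
move=> j k ji ki; apply: le_trans (ler_distD (ln (Lam j0 i)) _ _) _.
have := near_j0 j ji; have := near_j0 k ki; rewrite [in leLHS]distrC.
lra.
Unshelve. all: by end_near.
Qed.

End Dissipation.

(** * Fluid solutions and the left rate of decrease of [beta] *)

Section Fluid.
Variables (R : realType) (J I : finType) (r : I -> seq J) (mu : J -> I -> R).
Variables (n : I -> R) (m L : R -> J -> I -> R).
Hypothesis ur : forall i, uniq (r i).
Hypothesis mu0 : forall i j, j \in r i -> 0 < mu j i.
Hypothesis fluid : fluid_solution r mu n m L.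

Lemma fluid_feasible t : 0 <= t -> feasible r n (m t).
Proof. by case: fluid => _ _ _ mn m0 t0; split=> *; [exact: m0|exact: mn]. Qed.

Lemma fluid_increment s t i j : 0 <= s -> s <= t -> j \in r i ->
  m t j i - m s j i =
  (L t (prev (r i) j) i - L s (prev (r i) j) i) - (L t j i - L s j i).
Proof.
case: fluid => -[mE _] _ _ _ _ s0 st ji.
by rewrite (mE t)// ?(le_trans s0)// (mE s)//; ring.
Qed.

(** Increments are nonnegative, so each class alone obeys the capacity bound of its queue. *)
Lemma fluid_lipschitz s t i j : 0 <= s -> 0 <= t -> j \in r i ->
  `|L t j i - L s j i| <= mu j i * `|t - s|.
Proof.
case: fluid => -[_ cap] mono _ _ _.
wlog st : s t / s <= t => [H|] s0 t0 ji.
  have [st|/ltW ts] := leP s t; first exact: H.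
  by rewrite distrC (distrC t) H.
rewrite !ger0_norm ?subr_ge0 ?mono// mulrC -ler_pdivrMr ?mu0//.
apply: le_trans (cap s t j s0 st).
apply: (@ler_term_sum _ _ (fun i => j \in r i) (fun i => (L t j i - L s j i) / mu j i)) => //.
by move=> k jk; rewrite divr_ge0 ?subr_ge0 ?mono// ltW// mu0.
Qed.

(* Extending a solution by its initial value to negative times makes it
   continuous on the whole line. *)
Lemma fluid_beta_continuous : continuous (fun t : R => beta r mu (m (Num.max t 0)) : R).
Proof.
have max0 (t : R) : 0 <= Num.max t 0 by rewrite le_max lexx orbT.
have Lc i j : j \in r i -> continuous (fun t : R => L (Num.max t 0) j i).
  move=> ji t; apply/cvgrPdist_le => e e0.
  have muji := mu0 ji.
  near=> s; apply: le_trans (fluid_lipschitz _ _ ji) _ => //.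
  have ts : `|t - s| <= e / mu j i.
    by near: s; apply: cvgr_dist_le; [exact: cvg_id|rewrite divr_gt0].
  rewrite mulrC -ler_pdivlMr//; apply: le_trans ts.
  have [t0|t0] := leP t 0; have [s0|s0] := leP s 0;
    rewrite ?subrr ?normr0 ?sub0r ?subr0 ?normrN//.
  - by rewrite gtr0_norm ?ler0_norm; lra.
  - by rewrite !ger0_norm; lra.
case: fluid => -[mE _] _ _ _ _ t.
apply: (@cvg_beta _ _ _ _ _ mu0 _ (nbhs t) (fun t => m (Num.max t 0))).
  by apply: nearW => s; exact: (fluid_feasible (max0 s)).1.
move=> i j ji; rewrite mE//.
have pj : prev (r i) j \in r i by rewrite mem_prev.
under eq_cvg do rewrite mE//.
apply: cvgB.
  by apply: cvgD; [exact: cvg_cst|apply: cvgB; [exact: Lc|exact: cvg_cst]].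
by apply: cvgB; [exact: Lc|exact: cvg_cst].
Unshelve. all: by end_near.
Qed.

Definition mean_rate t s j i : R := (L t j i - L s j i) / (t - s).

Lemma mean_rate_cvg t i j : 0 < t -> j \in r i -> 0 < mtot r (m t) j ->
  mean_rate t s j i @[s --> t^'-] --> mu j i * m t j i / mtot r (m t) j.
Proof.
case: fluid => _ _ der _ _ t0 ji mj.
exact: (is_derive_cvg_left (der t i j t0 ji mj)).
Qed.

Lemma mean_rate_service_feasible t s : 0 <= s -> s < t ->
  service_feasible r mu (mean_rate t s).
Proof.
case: fluid => -[_ cap] mono _ _ _ s0 st; have ts : 0 < t - s by lra.
split=> [i j ji|j].
  by rewrite divr_ge0 ?(ltW ts)// subr_ge0 mono// ltW.
have := cap s t j s0 (ltW st); rewrite -[X in _ <= X -> _]mul1r -ler_pdivrMr//.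
by rewrite mulr_suml; congr (_ <= _); apply: eq_bigr => i _; rewrite mulrAC.
Qed.

(* An empty class passes on at least what it receives, so a positive rate
   propagates from any nonempty class of the route all around the cycle. *)
Lemma mean_rate_lbound t i j : 0 < t -> 0 < n i -> j \in r i ->
  exists2 c, 0 < c & \forall s \near t^'-, c <= mean_rate t s j i.
Proof.
move=> t0 ni; have [m0 mn] := fluid_feasible (ltW t0).
have nonempty k : k \in r i -> 0 < m t k i ->
    exists2 c, 0 < c & \forall s \near t^'-, c <= mean_rate t s k i.
  move=> ki mk; have totk : 0 < mtot r (m t) k by apply: lt_le_trans (mtot_ge m0 ki).
  have l0 : 0 < mu k i * m t k i / mtot r (m t) k by rewrite divr_gt0 ?mulr_gt0 ?mu0.
  exists (mu k i * m t k i / mtot r (m t) k / 2); first by rewrite divr_gt0.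
  by apply: (cvgr_ge _ (mean_rate_cvg t0 ki totk)); lra.
have [k ki mk] : exists2 k, k \in r i & 0 < m t k i.
  apply: contrapT => hN.
  have : \sum_(k <- r i) m t k i <= 0.
    rewrite big_seq; apply: sumr_le0 => k ki.
    by rewrite leNgt; apply/negP => h; apply: hN; exists k.
  by rewrite mn leNgt ni.
move: j; apply: (cyclic_ind (Q := fun j => exists2 c, 0 < c &
  \forall s \near t^'-, c <= mean_rate t s j i) (ur i) ki (nonempty k ki mk)).
move=> l li [c c0 cP].
have [ml|ml] := ltP 0 (m t l i); first exact: nonempty.
exists c => //; near=> s.
have s0 : 0 < s by near: s; exact: nbhs_left_gt.
have st : s < t by near: s; exact: nbhs_left_lt.
have cs : c <= mean_rate t s (prev (r i) l) i by near: s.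
apply: le_trans cs _; rewrite ler_pM2r ?invr_gt0 ?subr_gt0//.
have := fluid_increment (ltW s0) (ltW st) li.
have := (fluid_feasible (ltW s0)).1 _ _ li; lra.
Unshelve. all: by end_near.
Qed.

(** There are finitely many classes, so one constant serves them all; it later bounds the logarithms
    of the rates from below, uniformly in [s]. *)
Lemma mean_rate_uniform_lbound t : 0 < t ->
  exists2 c, 0 < c & \forall s \near t^'-, forall i j, j \in r i -> 0 < n i ->
    c <= mean_rate t s j i.
Proof.
move=> t0.
have H : \forall c \near (0 : R)^'+, forall x : I * J, x.2 \in r x.1 -> 0 < n x.1 ->
    \forall s \near t^'-, c <= mean_rate t s x.2 x.1.
  apply: filter_forall => -[i j] /=.
  have [ji|_] := boolP (j \in r i); last exact: nearW.
  have [ni|_] := boolP (0 < n i); last exact: nearW.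
  have [c c0 cP] := mean_rate_lbound t0 ni ji.
  near=> d => _ _; have dc : d <= c by near: d; exact: nbhs_right_le.
  by apply: filterS cP => s; exact: le_trans.
near (0 : R)^'+ => c; exists c; first by near: c; exact: nbhs_right_gt.
have Hc : forall x : I * J, x.2 \in r x.1 -> 0 < n x.1 ->
    \forall s \near t^'-, c <= mean_rate t s x.2 x.1 by near: c.
suff : \forall s \near t^'-, forall x : I * J, x.2 \in r x.1 -> 0 < n x.1 ->
    c <= mean_rate t s x.2 x.1.
  by apply: filterS => s h i j; exact: (h (i, j)).
apply: filter_forall => x.
have [ji|_] := boolP (x.2 \in r x.1); last exact: nearW.
have [ni|_] := boolP (0 < n x.1); last exact: nearW.
by apply: filterS (Hc x ji ni) => s h.
Unshelve. all: by end_near.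
Qed.

(** Summation by parts around each route; routes with [n i <= 0] carry no mass. If the increments of
    [L] are close to [t - s] times [Lam], the right side is close to minus [t - s] times the
    dissipation. *)
Lemma mass_diff_sum s t Lam : 0 <= s -> s <= t ->
  \sum_j \sum_(i | j \in r i) (m t j i - m s j i) * ln (Lam j i) =
  \sum_(i | 0 < n i) \sum_(j <- r i)
    (L t (prev (r i) j) i - L s (prev (r i) j) i) *
    (ln (Lam j i) - ln (Lam (prev (r i) j) i)).
Proof.
move=> s0 st; have t0 := le_trans s0 st.
rewrite sum_routes// [RHS]big_mkcond/=; apply: eq_bigr => i _.
case: ifPn => [ni|].
  transitivity (\sum_(j <- r i) (L t (prev (r i) j) i - L s (prev (r i) j) i) * ln (Lam j i)
      - \sum_(j <- r i) (L t j i - L s j i) * ln (Lam j i)).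
    rewrite -sumrB big_seq [RHS]big_seq; apply: eq_bigr => j ji.
    by rewrite fluid_increment// mulrBl.
  rewrite -(big_prev (fun j => (L t j i - L s j i) * ln (Lam j i)) (ur i)) -sumrB.
  by apply: eq_bigr => j _; rewrite mulrBr.
rewrite -leNgt => ni; rewrite big_seq big1// => j ji.
have z u : 0 <= u -> m u j i = 0.
  move=> u0; have fu := fluid_feasible u0; apply/eqP; rewrite eq_le fu.1// andbT.
  by apply: le_trans ni; exact: (feasible_le ur fu ji).
by rewrite !z// subrr mul0r.
Qed.

(* Lam is the vector of instantaneous rates at nonempty queues and of mean rates
   over [s, t] at empty ones; it is optimal in the Gibbs inequality for m t and
   feasible for m s, which bounds the increment of beta. *)
Lemma beta_decrement t e : 0 < t -> 0 < e ->
  \forall s \near t^'-, exists2 Lam, rates_of r mu n (m t) Lam &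
    beta r mu (m t) - beta r mu (m s) <= (t - s) * (e - dissipation r n Lam).
Proof.
move=> t0 e0; have ft := fluid_feasible (ltW t0).
have [c c0 cP] := mean_rate_uniform_lbound t0.
pose Lt j i := mu j i * m t j i / mtot r (m t) j.
pose Lam s j i := if 0 < mtot r (m t) j then Lt j i else mean_rate t s j i.
(* On routes with [0 < n i] all rates lie between [c] and [C], so [B] bounds their logarithms
   independently of [s]. *)
pose C := 1 + \sum_j \sum_(i | j \in r i) mu j i.
have sum_mu i j : j \in r i -> mu j i <= \sum_j \sum_(i | j \in r i) mu j i.
  by apply: ler_term_routes => k l lk; rewrite ltW// mu0.
pose B := `|ln c| + `|ln C|.
have B0 : 0 <= B by rewrite addr_ge0.
(* [N] counts the classes on routes with [0 < n i]. Replacing a mean rate by [Lam] costs at most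
   [2 * B * e1] for each of them, in total at most [e]. *)
pose N : R := \sum_(i | 0 < n i) \sum_(j <- r i) 1.
have N0 : 0 <= N by apply: sumr_ge0 => i _; exact: sumr_ge0.
have NB1 : 0 < 1 + N * (2 * B) by have := mulr_ge0 N0 B0; lra.
pose e1 := e / (1 + N * (2 * B)).
have e10 : 0 < e1 by rewrite divr_gt0.
have close : \forall s \near t^'-, forall x : I * J, x.2 \in r x.1 ->
    0 < mtot r (m t) x.2 -> `|Lt x.2 x.1 - mean_rate t s x.2 x.1| <= e1.
  apply: filter_forall => -[i j] /=.
  have [ji|_] := boolP (j \in r i); last exact: nearW.
  have [mj|_] := boolP (0 < mtot r (m t) j); last exact: nearW.
  have /cvgrPdist_le/(_ e1 e10) := mean_rate_cvg t0 ji mj.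
  by apply: filterS => s h.
have cLt i j : j \in r i -> 0 < n i -> 0 < mtot r (m t) j -> c <= Lt j i.
  move=> ji ni mj; apply: (cvgr_to_ge (mean_rate_cvg t0 ji mj)).
  by apply: filterS cP => s; apply.
near=> s.
have s0 : 0 < s by near: s; exact: nbhs_left_gt.
have st : s < t by near: s; exact: nbhs_left_lt.
have cs : forall i j, j \in r i -> 0 < n i -> c <= mean_rate t s j i by near: s.
have LK : service_feasible r mu (Lam s).
  have [mr0 mrK] := mean_rate_service_feasible (ltW s0) st.
  split=> [i j ji|j]; rewrite /Lam; case: (boolP (0 < mtot r (m t) j)) => mj //.
  - by rewrite divr_ge0 ?mulr_ge0 ?(ltW mj) ?ft.1// ltW// mu0.
  - exact: mr0.
  - rewrite (eq_bigr (fun i => m t j i / mtot r (m t) j)) => [|i ji].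
      by rewrite -mulr_suml divff// gt_eqF.
    by rewrite /Lt; field; rewrite !gt_eqF ?mu0.
have cL i j : j \in r i -> 0 < n i -> c <= Lam s j i.
  by move=> ji ni; rewrite /Lam; case: ifPn => mj; [exact: cLt|exact: cs].
have L0 i j : j \in r i -> 0 < n i -> 0 < Lam s j i.
  by move=> ji ni; exact: lt_le_trans (cL _ _ ji ni).
have rL : rates_of r mu n (m t) (Lam s).
  by split=> // i j ji mji; rewrite /Lam (lt_le_trans mji (mtot_ge ft.1 ji)).
exists (Lam s) => //.
have fs := fluid_feasible (ltW s0).
rewrite (beta_rates ft.1 rL).
have gs := gibbs mu0 fs.1 LK (fun i j ji mji => L0 i j ji (feasible_gt0 ur fs ji mji)).
apply: le_trans (lerB (lexx _) gs) _.
rewrite -sumrB; under eq_bigr do rewrite -sumrB.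
under eq_bigr do under eq_bigr do rewrite -mulrBl.
rewrite mass_diff_sum ?(ltW s0) ?(ltW st)//.
have ts : 0 < t - s by lra.
have lnB i j : j \in r i -> 0 < n i -> `|ln (Lam s j i)| <= B.
  move=> ji ni; have Lji := L0 _ _ ji ni.
  have l1 : ln c <= ln (Lam s j i) by rewrite ler_ln ?posrE// cL.
  have LC : Lam s j i <= C.
    have := service_feasible_le mu0 LK ji; have := sum_mu _ _ ji; rewrite /C; lra.
  have l2 : ln (Lam s j i) <= ln C by rewrite ler_ln ?posrE// (lt_le_trans Lji).
  rewrite /B ler_norml; have := ler_norm (ln C); have := ler_norm (- ln c).
  by rewrite normrN; have := normr_ge0 (ln C); have := normr_ge0 (ln c); lra.
have close' i j : j \in r i -> `|mean_rate t s j i - Lam s j i| <= e1.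
  move=> ji; rewrite /Lam; case: ifPn => mj; last by rewrite subrr normr0 ltW.
  rewrite distrC; have : forall x : I * J, x.2 \in r x.1 ->
    0 < mtot r (m t) x.2 -> `|Lt x.2 x.1 - mean_rate t s x.2 x.1| <= e1 by near: s.
  by move=> /(_ (i, j)); exact.
have eN : N * (2 * B * e1) <= e.
  have -> : N * (2 * B * e1) = e * (N * (2 * B)) / (1 + N * (2 * B)) by rewrite /e1; ring.
  by rewrite ler_pdivrMr// ler_pM2l// lerDr.
apply: (@le_trans _ _ ((t - s) * (N * (2 * B * e1) - dissipation r n (Lam s)))); last first.
  by rewrite ler_pM2l// lerB.
rewrite /N /dissipation mulr_suml -sumrB mulr_sumr; apply: ler_sum => i ni.
rewrite mulr_suml -sumrB mulr_sumr big_seq [leRHS]big_seq; apply: ler_sum => j ji.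
have pj : prev (r i) j \in r i by rewrite mem_prev.
have -> : L t (prev (r i) j) i - L s (prev (r i) j) i =
    (t - s) * mean_rate t s (prev (r i) j) i.
  by rewrite /mean_rate; field; rewrite gt_eqF.
rewrite -[leLHS]mulrA ler_pM2l// mul1r.
have := lnB _ _ ji ni; have := lnB _ _ pj ni; have := close' _ _ pj.
set x := mean_rate _ _ _ _; set y := Lam _ _ _; set u := ln _; set v := ln _.
move=> xy yB vB.
have : (x - y) * (v - u) <= 2 * B * e1.
  apply: le_trans (ler_norm _) _; rewrite normrM mulrC ler_pM//.
  by apply: le_trans (ler_normB _ _) _; lra.
rewrite /u; lra.
Unshelve. all: by end_near.
Qed.

End Fluid.

(** * Convergence of [beta] to its minimum *)

Section Convergence.
Variables (R : realType) (J I : finType) (r : I -> seq J) (mu : J -> I -> R).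
Variables (n : I -> R) (m L : R -> J -> I -> R).
Hypothesis ur : forall i, uniq (r i).
Hypothesis mu0 : forall i j, j \in r i -> 0 < mu j i.
Hypothesis n0 : forall i, 0 <= n i.
Hypothesis fluid : fluid_solution r mu n m L.

(** The bound [k] is required for all admissible [Lam], because the rates that [beta_decrement]
    supplies at empty queues vary with the left end point. *)
Lemma beta_decrease_rate k :
  (forall t Lam, 0 < t -> rates_of r mu n (m t) Lam -> k <= dissipation r n Lam) ->
  forall s t, 0 <= s -> s <= t ->
  beta r mu (m t) - beta r mu (m s) <= - k * (t - s).
Proof.
move=> kD s t s0 st.
have := @left_dini_decrease _ _ k (fluid_beta_continuous mu0 fluid) _ s t s0 st.
rewrite !max_l ?(le_trans s0)//; apply => u u0 e e0.
have := beta_decrement ur mu0 fluid u0 e0.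
apply: filter_app; near=> v => -[Lam rL].
have v0 : 0 < v by near: v; exact: nbhs_left_gt.
have vu : v < u by near: v; exact: nbhs_left_lt.
rewrite !max_l ?(ltW v0) ?(ltW u0)// => h; apply: le_trans h _.
by rewrite ler_pM2l ?subr_gt0// lerB// (kD u).
Unshelve. all: by end_near.
Qed.

Lemma beta_nonincreasing s t : 0 <= s -> s <= t ->
  beta r mu (m t) <= beta r mu (m s).
Proof.
move=> s0 st; have := @beta_decrease_rate 0 _ s t s0 st.
rewrite oppr0 mul0r subr_le0; apply => u Lam _ [_ L0 _].
exact: dissipation_ge0.
Qed.

(** Otherwise the dissipation stays above a fixed [eta], and [beta] eventually falls below its lower
    bound. *)
Lemma near_equal_rates (delta : R) : 0 < delta ->
  exists T Lam, [/\ 0 < T, rates_of r mu n (m T) Lam &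
    forall i j k, 0 < n i -> j \in r i -> k \in r i ->
      `|ln (Lam j i) - ln (Lam k i)| <= delta].
Proof.
move=> d0; apply: contrapT => hN.
have [eta eta0 small] := small_dissipation ur mu0 n0 d0.
have rate t Lam : 0 < t -> rates_of r mu n (m t) Lam -> eta <= dissipation r n Lam.
  move=> t0 rL; rewrite leNgt; apply/negP => dL; apply: hN; exists t, Lam; split=> //.
  exact: small (fluid_feasible fluid (ltW t0)) rL dL.
have [c cP] := beta_lbound ur mu0 n.
have c0 := cP _ (fluid_feasible fluid (lexx 0)).
(* By this time, decreasing at rate [eta] takes [beta] down to [c - 1]. *)
pose t := (beta r mu (m 0) - c + 1) / eta.
have t0 : 0 <= t by rewrite divr_ge0 ?(ltW eta0)//; lra.
have := beta_decrease_rate rate (lexx 0) t0.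
have := cP _ (fluid_feasible fluid t0).
have : eta * t = beta r mu (m 0) - c + 1 by rewrite mulrC divfK// gt_eqF.
lra.
Qed.

(** Shrinking one rate of each route by the factor [expR (- d)] puts it below all rates of that
    route, hence within capacity. The loss is at most [2 * d] per unit of mass. *)
Lemma near_optimal_throughput (delta : R) : 0 < delta ->
  exists T Lam, [/\ 0 < T, thr_feasible r mu n Lam &
    beta r mu (m T) <= thr_obj n Lam + delta].
Proof.
move=> d0; pose N := \sum_i n i.
have N0 : 0 <= N by apply: sumr_ge0.
have N1 : 0 < 2 * (N + 1) by lra.
pose d := delta / (2 * (N + 1)).
have dd0 : 0 < d by rewrite divr_gt0.
have [T [Lam [T0 rL osc]]] := near_equal_rates dd0.
have [[L0 LK] Lp _] := rL.
have fT := fluid_feasible fluid (ltW T0).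
(* The rate at the first queue is used. A route with [0 < n i] has a queue, so the inner default 0
   never occurs there. *)
pose Lh i := if 0 < n i then
  expR (- d) * (if r i is j :: _ then Lam j i else 0) else 0.
have LhE i : 0 < n i -> exists2 j, j \in r i & Lh i = expR (ln (Lam j i) - d).
  move=> ni; have := fT.2 i; rewrite /Lh ni.
  case E : (r i) => [|j q]; first by rewrite big_nil => z; rewrite z ltxx in ni.
  have ji : j \in r i by rewrite E mem_head.
  by exists j; rewrite ?mem_head// addrC expRD lnK// posrE Lp.
have Lhp i : 0 < n i -> 0 < Lh i by move=> /LhE[j _ ->]; exact: expR_gt0.
have Lh0 i : 0 <= Lh i.
  by have [/Lhp/ltW//|ni] := boolP (0 < n i); rewrite /Lh (negbTE ni).
have Lhle i j : j \in r i -> Lh i <= Lam j i.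
  move=> ji; have [ni|ni] := boolP (0 < n i); last by rewrite /Lh (negbTE ni) L0.
  have [k ki ->] := LhE i ni.
  rewrite -[leRHS]lnK ?posrE ?Lp// ler_expR.
  by have := osc i j k ni ji ki; rewrite ler_distlC => /andP[]; lra.
exists T, Lh; split=> //.
  split=> //; split=> // j; apply: le_trans (LK j); apply: ler_sum => i ji.
  by rewrite ler_pM2r ?invr_gt0 ?mu0// Lhle.
rewrite (beta_rates fT.1 rL) (thr_objE ur _ fT).
apply: (@le_trans _ _ (\sum_j \sum_(i | j \in r i) (m T j i * ln (Lh i) + m T j i * (2 * d)))).
  apply: ler_sum => j _; apply: ler_sum => i ji; rewrite -mulrDr.
  have := fT.1 _ _ ji; rewrite le_eqVlt => /predU1P[<-|mji]; first by rewrite !mul0r.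
  have ni := feasible_gt0 ur fT ji mji.
  rewrite ler_pM2l//; have [k ki ->] := LhE i ni; rewrite expRK.
  by have := osc i j k ni ji ki; rewrite ler_distl => /andP[]; lra.
under eq_bigr do rewrite big_split/=.
rewrite big_split/= lerD2l sum_routes//.
under eq_bigr do rewrite -mulr_suml fT.2.
rewrite -mulr_suml -/N /d mulrA mulrA ler_pdivrMr//; nra.
Qed.

Lemma betastar_le ms : feasible r n ms -> betastar r mu n <= beta r mu ms.
Proof.
move=> fm; apply: ge_inf; last by exists ms.
by have [c cP] := beta_lbound ur mu0 n; exists c => _ [m' fm' <-]; exact: cP.
Qed.

Lemma betastar_ge c : (forall ms, feasible r n ms -> c <= beta r mu ms) ->
  c <= betastar r mu n.
Proof.
move=> cP; apply: lb_le_inf; last by move=> _ [m' fm' <-]; exact: cP.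
by exists (beta r mu (m 0)), (m 0) => //; exact: (fluid_feasible fluid (lexx 0)).
Qed.

(** At time [T], [beta] is within [e] of a throughput value, which weak duality puts below
    [betastar]; monotonicity keeps it there. *)
Lemma beta_cvg_betastar :
  (fun t => beta r mu (m t)) @ +oo --> betastar r mu n.
Proof.
apply/cvgrPdist_le => e e0; have [T [Lam [T0 fL bT]]] := near_optimal_throughput e0.
near=> t; have Tt : T <= t by near: t; apply: nbhs_pinfty_ge; rewrite num_real.
have t0 : 0 <= t by rewrite (le_trans _ Tt)// ltW.
have h1 := beta_nonincreasing (ltW T0) Tt.
have h2 := betastar_le (fluid_feasible fluid t0).
have h3 : thr_obj n Lam <= betastar r mu n.
  by apply: betastar_ge => ms fms; exact: weak_duality.
by rewrite ler0_norm ?subr_le0//; lra.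
Unshelve. all: by end_near.
Qed.

(** * Convergence to the set of minimizers *)

(** Bounded masses converge along an ultrafilter, and continuity of [beta] gives the limit the value
    [betastar]. *)
Lemma fluid_ultra_limit (U : set_system R) :
  UltraFilter U -> (+oo : set_system R) `<=` U ->
  exists2 ms, Mset r mu n ms &
    forall i j, j \in r i -> m t j i @[t --> U] --> ms j i.
Proof.
move=> UU infU; have PU := ultra_proper.
have feas : \forall t \near U, feasible r n (m t).
  apply: infU; near=> t; apply: (fluid_feasible fluid).
  by near: t; apply: nbhs_pinfty_ge; rewrite num_real.
have lim_ex (x : I * J) : exists l : R, x.2 \in r x.1 -> m t x.2 x.1 @[t --> U] --> l.
  have [ji|] := boolP (x.2 \in r x.1); last by exists 0.
  have [l lP] : exists l : R, m t x.2 x.1 @[t --> U] --> l; last by exists l.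
  apply: (@ultra_bounded_cvg _ _ _ _ 0 (n x.1)).
  by apply: filterS feas => t ft; rewrite ft.1//= (feasible_le ur ft).
have [l lP] := choice lim_ex.
pose ms j i := l (i, j).
have cms i j : j \in r i -> m t j i @[t --> U] --> ms j i by exact: lP (i, j).
have fms : feasible r n ms.
  split=> [i j ji|i].
    by apply: (cvgr_to_ge (cms _ _ ji)); apply: filterS feas => t ft; exact: ft.1.
  have h : \sum_(j | j \in r i) m t j i @[t --> U] --> \sum_(j | j \in r i) ms j i.
    by apply: cvg_sumr => j; exact: cms.
  rewrite big_uniq//; apply/eqP; rewrite eq_le; apply/andP; split.
    apply: (cvgr_to_le h); apply: filterS feas => t ft.
    by have := ft.2 i; rewrite big_uniq//= => ->.
  apply: (cvgr_to_ge h); apply: filterS feas => t ft.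
  by have := ft.2 i; rewrite big_uniq//= => ->.
exists ms => //; split=> // m' fm'; apply: le_trans (betastar_le fm').
have b1 : beta r mu (m t) @[t --> U] --> beta r mu ms.
  by apply: (cvg_beta mu0) => //; apply: filterS feas => t [].
have b2 : beta r mu (m t) @[t --> U] --> betastar r mu n.
  by move=> A /beta_cvg_betastar /infU.
by rewrite (cvg_unique _ b1 b2).
Unshelve. all: by end_near.
Qed.

Lemma Mset_nonempty : Mset r mu n !=set0.
Proof.
have [U [UU infU]] := @ultraFilterLemma R (+oo : set_system R) _.
by have [ms Mms _] := fluid_ultra_limit UU infU; exists ms.
Qed.

(** If the distance exceeded [e] at arbitrarily large times, the masses would converge to a
    minimizer along an ultrafilter containing those times, a contradiction. *)
Lemma fluid_cvg_Mset :
  (fun t => inf [set enorm r (m t - ms) | ms in Mset r mu n]) @ +oo --> (0 : R).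
Proof.
pose dist t := inf [set enorm r (m t - ms) | ms in Mset r mu n].
have dist_ge0 t : 0 <= dist t.
  apply: lb_le_inf; last by move=> _ [ms _ <-]; exact: sqrtr_ge0.
  by have [ms Mms] := Mset_nonempty; exists (enorm r (m t - ms)), ms.
have dist_le t ms : Mset r mu n ms -> dist t <= enorm r (m t - ms).
  move=> Mms; apply: ge_inf; last by exists ms.
  by exists 0 => _ [m' _ <-]; exact: sqrtr_ge0.
apply/cvgr0Pnorm_le => e e0; apply: contrapT => hN.
pose A := [set t | e < dist t].
have PA : ProperFilter (within A (+oo : set_system R)).
  apply: Build_ProperFilter => /= hA; apply: hN.
  near=> t; rewrite ger0_norm ?dist_ge0// leNgt; apply/negP.
  by near: t.
have [U [UU sU]] := ultraFilterLemma PA.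
have PU := @ultra_proper _ _ UU.
have infU : (+oo : set_system R) `<=` U.
  by move=> B hB; apply: sU; apply: filterS hB => t Bt _.
have [ms Mms cms] := fluid_ultra_limit UU infU.
have UA : U A by apply: sU; exact: nearW.
have : enorm r (m t - ms) @[t --> U] --> Num.sqrt (0 : R).
  apply: (continuous_cvg _ (@sqrt_continuous R 0)).
  rewrite -[X in _ --> X](_ : \sum_j \sum_(i | j \in r i) 0 = 0); last first.
    by rewrite big1// => j _; rewrite big1.
  under eq_cvg do rewrite -sum_routes//.
  apply: cvg_sumr => j _; apply: cvg_sumr => i ji.
  have h : (m t - ms) j i @[t --> U] --> (0 : R).
    by rewrite -(subrr (ms j i)); apply: cvgB; [exact: cms|exact: cvg_cst].
  by have := cvgM h h; rewrite mulr0; exact.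
rewrite sqrtr0 => /cvgr0Pnorm_lt /(_ e e0) hU.
have [t [/= At]] := @filter_ex _ _ PU _ (filterI UA hU).
rewrite ger0_norm ?sqrtr_ge0// => ht.
by have := lt_trans At (le_lt_trans (dist_le t ms Mms) ht); rewrite ltxx.
Unshelve. all: by end_near.
Qed.

(** * Attainment of the throughput optimum *)

Lemma thr_obj_pos (Lam : I -> R) :
  thr_obj n Lam = \sum_(i | 0 < n i) n i * ln (Lam i).
Proof.
rewrite /thr_obj [RHS]big_mkcond/=; apply: eq_bigr => i _; case: ltP => // ni.
have -> : n i = 0 by apply/eqP; rewrite eq_le ni n0.
by rewrite mul0r.
Qed.

(** A limit of throughputs with vanishing gap. It is taken on the logarithms, which are bounded on
    both sides, so that throughputs of routes with [0 < n i] stay positive. *)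
Lemma strong_duality :
  exists2 Lam, thr_feasible r mu n Lam & betastar r mu n <= thr_obj n Lam.
Proof.
have approx (k : nat) : exists Lam, thr_feasible r mu n Lam /\
    betastar r mu n <= thr_obj n Lam + k.+1%:R^-1.
  have [|T [Lam [T0 fL bT]]] := @near_optimal_throughput (k.+1%:R^-1).
    by rewrite invr_gt0.
  exists Lam; split=> //; apply: le_trans bT.
  exact: betastar_le (fluid_feasible fluid (ltW T0)).
have [Lk LkP] := choice approx.
have [U [UU infU]] := @ultraFilterLemma nat \oo _.
have PU := @ultra_proper _ _ UU.
pose C := 1 + \sum_j \sum_(i | j \in r i) mu j i.
have sum_mu i j : j \in r i -> mu j i <= \sum_j \sum_(i | j \in r i) mu j i.
  by apply: ler_term_routes => k l lk; rewrite ltW// mu0.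
have C1 : 1 <= C.
  rewrite /C lerDl; apply: sumr_ge0 => j _; apply: sumr_ge0 => i ji.
  by rewrite ltW// mu0.
have Lk0 k i : 0 < n i -> 0 < Lk k i by exact: (LkP k).1.2.1.
have yC k i : 0 < n i -> ln (Lk k i) <= ln C.
  move=> ni; rewrite ler_ln ?posrE ?Lk0//; last by lra.
  have := (fluid_feasible fluid (lexx 0)).2 i.
  case E : (r i) => [|j q]; first by rewrite big_nil => z; rewrite -z ltxx in ni.
  move=> _; have ji : j \in r i by rewrite E mem_head.
  have := service_feasible_le mu0 (thr_service_feasible (LkP k).1) ji.
  by have := sum_mu _ _ ji; rewrite /C; lra.
pose N := \sum_(i | 0 < n i) n i.
(* All logarithms are at most [ln C] while the objective is at least [betastar r mu n - 1], so no
   single route can fall far short. *)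
have ylow k i : 0 < n i -> ln C - (N * ln C - betastar r mu n + 1) / n i <= ln (Lk k i).
  move=> ni; rewrite lerBlDr -lerBlDl ler_pdivlMr// mulrC.
  have := (LkP k).2; rewrite thr_obj_pos.
  have : \sum_(i | 0 < n i) n i * (ln C - ln (Lk k i)) =
      N * ln C - \sum_(i | 0 < n i) n i * ln (Lk k i).
    by under eq_bigr do rewrite mulrBr; rewrite sumrB mulr_suml.
  have : n i * (ln C - ln (Lk k i)) <= \sum_(i | 0 < n i) n i * (ln C - ln (Lk k i)).
    apply: (@ler_term_sum _ _ (fun i => 0 < n i) (fun i => n i * (ln C - ln (Lk k i)))) => //.
    by move=> l nl; rewrite mulr_ge0 ?n0// subr_ge0 yC.
  have : k.+1%:R^-1 <= 1 :> R by rewrite invf_le1// ler1n.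
  move=> h1 h2 h3 h4; have {h1 h4} := le_trans h4 (lerD (lexx _) h1).
  by rewrite h3 in h2; move: h2; move: (\sum_(_ | _) _) => S; lra.
have lim_ex i : exists l : R, 0 < n i -> ln (Lk k i) @[k --> U] --> l.
  have [ni|] := boolP (0 < n i); last by exists 0.
  have [l lP] : exists l : R, ln (Lk k i) @[k --> U] --> l; last by exists l.
  by apply: (ultra_bounded_cvg UU); apply: nearW => k; apply/andP; split; [exact: ylow|exact: yC].
have [l lP] := choice lim_ex.
(* The value 0 on the remaining routes only drops nonnegative terms from the capacity
   constraints. *)
pose Lam i := if 0 < n i then expR (l i) else 0.
exists Lam.
  split; first by move=> i; rewrite /Lam; case: ifP => // _; exact: expR_ge0.
  split; first by move=> i ni; rewrite /Lam ni expR_gt0.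
  move=> j.
  have -> : \sum_(i | j \in r i) Lam i / mu j i =
      \sum_(i | (j \in r i) && (0 < n i)) expR (l i) / mu j i.
    rewrite big_mkcondr/=; apply: eq_bigr => i _.
    by rewrite /Lam; case: ifP => // _; rewrite mul0r.
  have : \sum_(i | (j \in r i) && (0 < n i)) Lk k i / mu j i @[k --> U] -->
      \sum_(i | (j \in r i) && (0 < n i)) expR (l i) / mu j i.
    apply: cvg_sumr => i /andP[_ ni]; apply: cvgM; last exact: cvg_cst.
    under eq_cvg do rewrite -[Lk _ i]lnK ?posrE ?Lk0//.
    exact: (continuous_cvg _ (@continuous_expR R (l i)) (lP i ni)).
  move=> h; apply: (cvgr_to_le h); apply: nearW => k.
  apply: le_trans ((LkP k).1.2.2 j); rewrite big_mkcondr/=; apply: ler_sum => i ji.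
  by case: ifP => // _; rewrite divr_ge0 ?(LkP k).1.1// ltW// mu0.
rewrite thr_obj_pos -[leRHS]addr0.
have invk : k.+1%:R^-1 @[k --> U] --> (0 : R).
  by move=> A /(@cvg_harmonic R) /infU.
have h : \sum_(i | 0 < n i) n i * ln (Lk k i) + k.+1%:R^-1 @[k --> U] -->
    \sum_(i | 0 < n i) n i * ln (Lam i) + 0.
  apply: cvgD => //; apply: cvg_sumr => i ni; apply: cvgM; first exact: cvg_cst.
  by rewrite /Lam ni expRK; exact: lP.
apply: (cvgr_to_ge h); apply: nearW => k; rewrite -thr_obj_pos.
exact: (LkP k).2.
Qed.

End Convergence.

Theorem theorem4 (R : realType) (J I : finType) (r : I -> seq J)
    (mu : J -> I -> R) (n : I -> R)
    (m : R -> J -> I -> R) (L : R -> J -> I -> R) :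
  (forall i, uniq (r i)) ->
  (forall i j, j \in r i -> 0 < mu j i) ->
  (forall i, 0 <= n i) ->
  fluid_solution r mu n m L ->
  (forall i, \sum_(j <- r i) m 0 j i = n i) ->
  [/\ (forall s t, 0 <= s -> s <= t -> beta r mu (m t) <= beta r mu (m s)),
      (fun t => beta r mu (m t)) @ +oo --> betastar r mu n,
      Mset r mu n !=set0,
      (fun t => inf [set enorm r (m t - ms) | ms in Mset r mu n]) @ +oo --> (0 : R) &
      (exists Lam, thr_optimal r mu n Lam) /\
      (forall ms, Mset r mu n ms -> forall Lam, thr_optimal r mu n Lam ->
         forall i j, j \in r i -> 0 < ms j i ->
           mu j i * ms j i / mtot r ms j = Lam i)].
Proof.
move=> ur mu0 n0 fluid _.
have [Lam0 fL0 opt0] := strong_duality ur mu0 n0 fluid.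
split.
- by move=> s t; exact: (beta_nonincreasing ur mu0 fluid).
- exact: (beta_cvg_betastar ur mu0 n0 fluid).
- exact: (Mset_nonempty ur mu0 n0 fluid).
- exact: (fluid_cvg_Mset ur mu0 n0 fluid).
split.
  (* [Lam0] reaches [betastar], which weak duality makes an upper bound. *)
  exists Lam0; split=> // Lam fL; apply: le_trans opt0.
  by apply: (betastar_ge fluid) => ms fms; exact: weak_duality.
(* An optimal [Lam] does at least as well as [Lam0], so it has no gap with the minimizer [ms] and
   the equality case applies. *)
move=> ms [fms min_ms] Lam [fL optL]; apply: (duality_eq ur mu0 fms fL).
apply: le_trans (optL _ fL0); apply: le_trans opt0.
exact: (betastar_ge fluid).
Qed.
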